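(* Let $d\ge2$ and let $A\subseteq\mathbb{R}^d$ be a nonempty compact set. For any $t>0$, let $\Theta'_t(A)$ be the maximal number of pairwise disjoint open balls of radius $t$ centered in $M_t(A)$. Then, in the definition of the upper and lower outer box dimension, $\Theta_t(A)$ can be equivalently replaced by $\Theta_t'(A)$, i.e., $$\overline{\dim}^{\mathrm{out}}_B A=\limsup_{t\to0^+}\frac{\log\Theta'_t(A)}{-\log t}\qquad\text{and}\qquad \underline{\dim}^{\mathrm{out}}_B A=\liminf_{t\to0^+}\frac{\log\Theta'_t(A)}{-\log t}.$$
   Context: For a nonempty closed set $A\subset\mathbb{R}^d$, $\mathrm{Unp}(A)$ is the set of $y\in\mathbb{R}^d\setminus A$ having a unique nearest point $\pi_A(y)$ in $A$. The generalized normal bundle is $N(A)=\{(\pi_A(y),\frac{y-\pi_A(y)}{\mathrm{dist}(y,A)}):y\in \mathrm{Unp}(A)\}\subset\partial A\times\mathbb{S}^{d-1}$, where $\mathbb{S}^{d-1}$ is the unit sphere. The local reach of $A$ at $(x,u)\in N(A)$ is $\delta(A,x,u)=\sup\{t\ge 0:\pi_A(x+tu)=x\}\in(0,\infty]$, and $\delta(A,x,u):=0$ for $(x,u)\in(\mathbb{R}^d\times\mathbb{S}^{d-1})\setminus N(A)$. For $A$ compact and $t>0$ let $M_t(A)=\{x\in\partial A:\exists u\in\mathbb{S}^{d-1}\text{ with }t<\delta(A,x,u)\}$ and let $\Theta_t(A)$ be the minimal number of open sets of diameter at most $t$ needed to cover $M_t(A)$. The upper and lower outer box dimensions of $A$ are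 $\overline{\dim}^{\mathrm{out}}_B A=\limsup_{t\to0^+}\frac{\log\Theta_t(A)}{-\log t}$ and $\underline{\dim}^{\mathrm{out}}_B A=\liminf_{t\to0^+}\frac{\log\Theta_t(A)}{-\log t}$. *)

(* Defs.v *)
From mathcomp Require Import all_boot all_order all_algebra.
From mathcomp Require Import all_classical all_reals all_analysis.

Set Implicit Arguments.
Unset Strict Implicit.
Unset Printing Implicit Defensive.
Import Order.TTheory GRing.Theory Num.Theory.
Import numFieldNormedType.Exports.
Local Open Scope classical_set_scope.
Local Open Scope ring_scope.

Definition boundary (T : topologicalType) (A : set T) : set T :=
  closure A `\` interior A.

Section OuterBoxDimension.
Context {R : realType} {d : nat}.
Implicit Types (A U : set 'rV[R]_d) (x y u : 'rV[R]_d) (t : R).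

(* The library norm on 'rV[R]_d is the maximum norm, so metric notions are
   based on [enorm]. Both norms induce the topology used by [open], [closure],
   [interior] and [compact]. *)
Definition enorm x : R := Num.sqrt (\sum_(i < d) x 0 i ^+ 2).

Definition eball x t : set 'rV[R]_d := [set y | enorm (y - x) < t].

Definition esphere : set 'rV[R]_d := [set u | enorm u = 1].

(* The diameter of the empty set is -oo. *)
Definition diameter U : \bar R :=
  ereal_sup [set (enorm (x - y))%:E | x in U & y in U].

Definition dist y A : R := inf [set enorm (y - a) | a in A].

Definition nearest A y x : Prop := A x /\ enorm (y - x) = dist y A.

(* [is_proj A y x] reads "pi_A(y) is defined and equal to x". A relation is
   used because a total function would take junk values where the nearest
   point is not unique. For y in A it holds exactly when x = y. *)
Definition is_proj A y x : Prop := unique (nearest A y) x.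

Definition Unp A : set 'rV[R]_d := [set y | ~ A y /\ exists x, is_proj A y x].

Definition normal_bundle A : set ('rV[R]_d * 'rV[R]_d) :=
  [set xu | exists2 y, Unp A y &
    is_proj A y xu.1 /\ xu.2 = (dist y A)^-1 *: (y - xu.1)].

Definition local_reach A x u : \bar R :=
  if (x, u) \in normal_bundle A then
    ereal_sup [set t%:E | t in [set t | 0 <= t /\ is_proj A (x + t *: u) x]]
  else 0%E.

Definition Mset A t : set 'rV[R]_d :=
  [set x | boundary A x /\ exists2 u, esphere u & (t%:E < local_reach A x u)%E].

(* Both counting numbers are extended reals: the infimum is +oo if there is no
   finite cover, the supremum is +oo if the families can be arbitrarily large. *)
Definition Theta A t : \bar R :=
  ereal_inf [set n%:R%:E | n in [set n : nat |
    exists U : 'I_n -> set 'rV[R]_d,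
      (forall i, open (U i) /\ (diameter (U i) <= t%:E)%E) /\
      Mset A t `<=` \bigcup_i U i]].

Definition Theta' A t : \bar R :=
  ereal_sup [set n%:R%:E | n in [set n : nat |
    exists c : 'I_n -> 'rV[R]_d,
      (forall i, Mset A t (c i)) /\
      trivIset [set: 'I_n] (fun i => eball (c i) t)]].

(* limsup and liminf as t -> 0+ of log (N t) / (- log t), with log 0 = -oo. *)
Definition upper_log_rate (N : R -> \bar R) : \bar R :=
  limf_esup (fun t => lne (N t) / (- ln t)%:E)%E (at_right 0).

Definition lower_log_rate (N : R -> \bar R) : \bar R :=
  limf_einf (fun t => lne (N t) / (- ln t)%:E)%E (at_right 0).

Definition upper_outer_box_dim A : \bar R := upper_log_rate (Theta A).

Definition lower_outer_box_dim A : \bar R := lower_log_rate (Theta A).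

End OuterBoxDimension.

(* Main.v *)
(** At each fixed scale t the two counting numbers agree up to a constant factor:
    Theta' A t <= Theta A t <= (8 d)^d * Theta' A t.
    On the left, centers of disjoint balls of radius t are more than t apart, so
    a set of diameter at most t contains at most one of them. On the right, the
    points of Mset A t lie within 2 t of the centers of a maximal packing, and
    each cube of half-side 2 t is covered by a grid of (8 d)^d cubes of half-side
    t / (2 d), whose Euclidean diameter is at most t. The constant disappears
    after taking logarithms and dividing by - log t. *)

Require Import Defs.
From mathcomp Require Import all_boot all_order all_algebra.
From mathcomp Require Import all_classical all_reals all_analysis.
From mathcomp Require Import ring lra.
Import Order.TTheory GRing.Theory Num.Theory.
Import numFieldNormedType.Exports.
Local Open Scope classical_set_scope.
Local Open Scope ring_scope.

(** The limsup is an infimum of suprema over members of the filter, so each member may first be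
    shrunk to where [f x <= g x + e%:E]. The slack [e] leaves room for the vanishing term
    [ln C / - ln t]. *)
Lemma limf_esup_le_near {T : choiceType} {X : filteredType T} {R : realType}
    (f g : X -> \bar R) (F : set_system X) : Filter F ->
  (forall e : R, 0 < e -> \forall x \near F, (f x <= g x + e%:E)%E) ->
  (limf_esup f F <= limf_esup g F)%E.
Proof.
move=> FF fg; apply/lee_addgt0Pr => e e0.
rewrite -leeBlDr//; apply/ereal_infP => _ [V FV <-]; rewrite leeBlDr//.
apply: (@le_trans _ _ (ereal_sup (f @` (V `&` [set x | f x <= g x + e%:E]%E)))).
  apply: ereal_inf_lbound; exists (V `&` [set x | f x <= g x + e%:E]%E) => //.
  by apply: filterI => //; exact: fg.
apply/ereal_supP => _ [x [Vx /= fgx] <-]; apply: (le_trans fgx).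
by rewrite leeD2r//; apply: ereal_sup_ubound; exists x.
Qed.

Lemma limf_einf_le_near {T : choiceType} {X : filteredType T} {R : realType}
    (f g : X -> \bar R) (F : set_system X) : Filter F ->
  (forall e : R, 0 < e -> \forall x \near F, (f x <= g x + e%:E)%E) ->
  (limf_einf f F <= limf_einf g F)%E.
Proof.
(* A liminf is minus the limsup of the negated function, so [f] and [g] trade places. *)
move=> FF fg; rewrite leeN2; apply: limf_esup_le_near => e /fg.
apply: filterS => x; rewrite /= leeNl oppeD ?fin_num_adde_defl// oppeK.
by rewrite leeBlDr.
Qed.

Lemma lne_ratio_le_near {R : realType} (N N' : R -> \bar R) (C : R) : 0 < C ->
  (forall t, 0 < t -> (0 <= N t)%E /\ (0 <= N' t)%E) ->
  (forall t, 0 < t -> (N t <= C%:E * N' t)%E) ->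
  forall e : R, 0 < e -> \forall t \near 0^'+,
    (lne (N t) / (- ln t)%:E <= lne (N' t) / (- ln t)%:E + e%:E)%E.
Proof.
move=> C0 N_ge0 NN' e e0; near=> t.
have t0 : 0 < t by near: t; exact: nbhs_right_gt.
have lnt0 : 0 < - ln t.
  by rewrite oppr_gt0 ln_lt0// t0/=; near: t; exact: nbhs_right_lt.
have lnC : ln C <= e * - ln t.
  (* This holds as soon as [t <= expR (- (ln C / e))]. *)
  have : ln t <= - (ln C / e).
    rewrite -[leRHS]expRK ler_ln ?posrE ?expR_gt0//; near: t.
    by apply: nbhs_right_le; exact: expR_gt0.
  by rewrite lerNr ler_pdivrMr// mulrC.
have [Nt0 N't0] := N_ge0 _ t0.
have lneN : (lne (N t) <= (ln C)%:E + lne (N' t))%E.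
  (* If [N' t = 0] then also [N t = 0], and both logarithms are [-oo]. *)
  move: N't0 (NN' _ t0); rewrite le_eqVlt => /orP[/eqP<-|N't0 NN't].
    by rewrite mule0 => /le0_lneNy ->; rewrite leNye.
  rewrite -lne_EFin// -lneM ?in_itv/= ?lte_fin ?C0 ?N't0 ?leey//.
  by rewrite lee_lne// in_itv/= leey andbT// (le_trans Nt0).
rewrite inver gt_eqF// lee_pdivrMr// muleDl//; last first.
  by rewrite fin_num_adde_defl.
rewrite -muleA -EFinM mulVf ?gt_eqF// mule1 addeC (le_trans lneN)//.
by rewrite leeD2r// lee_fin.
Unshelve. all: by end_near. Qed.

Lemma coord_le_enorm {R : realType} {d : nat} (x : 'rV[R]_d) i :
  `|x 0 i| <= enorm x.
Proof.
rewrite -sqrtr_sqr ler_wsqrtr// (bigD1 i)//= lerDl.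
by apply: sumr_ge0 => j _; exact: sqr_ge0.
Qed.

Lemma enormZ {R : realType} {d : nat} (a : R) (x : 'rV[R]_d) :
  enorm (a *: x) = `|a| * enorm x.
Proof.
rewrite /enorm -sqrtr_sqr -sqrtrM ?sqr_ge0// mulr_sumr; congr Num.sqrt.
by apply: eq_bigr => i _; rewrite mxE exprMn.
Qed.

(** The sharp factor is the square root of [d]; bounding [d] by its square gives the integer factor
    [d]. *)
Lemma enorm_le {R : realType} {d : nat} (x : 'rV[R]_d) (r : R) :
  0 <= r -> (forall i, `|x 0 i| <= r) -> enorm x <= d%:R * r.
Proof.
move=> r0 xr; rewrite -[leRHS]ger0_norm ?mulr_ge0// -sqrtr_sqr ler_wsqrtr//.
apply: (@le_trans _ _ (\sum_(i < d) r ^+ 2)).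
  apply: ler_sum => i _.
  by rewrite -[x 0 i ^+ 2]real_normK ?num_real// lerXn2r ?nnegrE.
rewrite sumr_const card_ord exprMn -[leLHS]mulr_natl ler_wpM2r ?sqr_ge0//.
by rewrite -natrX ler_nat; case: (d) => // n; rewrite expnS expn1 leq_pmull.
Qed.

Lemma diameter_ball_le {R : realType} {d : nat} (c : 'rV[R]_d) (r : R) :
  (diameter (ball c r) <= (d%:R * (2 * r))%:E)%E.
Proof.
(* Membership in a library [ball] carries the positivity [r0] of its radius. *)
apply/ereal_supP => _ [x [r0 cx] [y [_ cy] <-]]; rewrite lee_fin.
apply: enorm_le => [|i]; first by rewrite mulr_ge0// ltW.
rewrite !mxE; move: (cx 0 i) (cy 0 i); rewrite /ball/= => xr yr.
have -> : x 0 i - y 0 i = (c 0 i - y 0 i) - (c 0 i - x 0 i) by ring.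
by rewrite mulr_natl mulr2n ltW// (le_lt_trans (ler_normB _ _))// ltrD.
Qed.

(** The midpoint is at distance at most [t / 2] from both centers. *)
Lemma eball_meet {R : realType} {d : nat} (x y : 'rV[R]_d) (t : R) :
  0 < t -> enorm (x - y) <= t -> eball x t `&` eball y t !=set0.
Proof.
move=> t0 xyt; exists (2^-1 *: (x + y)).
have half_lt : `|2^-1| * enorm (x - y) < t.
  by rewrite ger0_norm ?invr_ge0//; lra.
split; rewrite /eball/=.
  have -> : 2^-1 *: (x + y) - x = (- 2^-1) *: (x - y).
    by apply/rowP => i; rewrite !mxE; field.
  by rewrite enormZ normrN.
have -> : 2^-1 *: (x + y) - y = 2^-1 *: (x - y).
  by apply/rowP => i; rewrite !mxE; field.
by rewrite enormZ.
Qed.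

Lemma eball_meet_coord {R : realType} {d : nat} (x y : 'rV[R]_d) (t : R) :
  eball x t `&` eball y t !=set0 -> forall i, `|x 0 i - y 0 i| < 2 * t.
Proof.
move=> [z [/= zx zy]] i.
have := le_lt_trans (coord_le_enorm _ i) zx.
have := le_lt_trans (coord_le_enorm _ i) zy.
rewrite !mxE => zyi zxi.
have -> : x 0 i - y 0 i = (z 0 i - y 0 i) - (z 0 i - x 0 i) by ring.
by rewrite mulr_natl mulr2n (le_lt_trans (ler_normB _ _))// ltrD.
Qed.

(* The library [ball]s of radius [s] at these points are the cubes of half-side
   [s] for the maximum norm; neighbouring ones overlap. *)
Definition grid {R : realType} {d K : nat} (c : 'rV[R]_d) (t s : R)
    (f : {ffun 'I_d -> 'I_K}) : 'rV[R]_d :=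
  \row_i (c 0 i - 2 * t + (f i)%:R * s).

(** In each coordinate the node just below [x 0 i] is chosen, by rounding down
    [(x 0 i - c 0 i + 2 * t) / s]. This quotient is less than [4 * t / s], hence the index is below
    [K]. *)
Lemma grid_cover {R : realType} {d K : nat} (c x : 'rV[R]_d) (t s : R) :
  0 < s -> 4 * t <= K%:R * s -> (forall i, `|c 0 i - x 0 i| < 2 * t) ->
  exists f : {ffun 'I_d -> 'I_K}, ball (grid c t s f) s x.
Proof.
move=> s0 tK cx.
have h i : exists k : 'I_K, `|c 0 i - 2 * t + k%:R * s - x 0 i| < s.
  have q0 : 0 <= (x 0 i - c 0 i + 2 * t) / s.
    by rewrite divr_ge0 ?ltW//; move: (cx i); rewrite ltr_norml => /andP[]; lra.
  have /andP[] := truncn_itv q0.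
  rewrite ler_pdivlMr// ltr_pdivrMr//; set k := Num.truncn _ => lk ku.
  have kK : (k < K)%N.
    rewrite -(ltr_nat R) -(ltr_pM2r s0) (le_lt_trans lk)// (lt_le_trans _ tK)//.
    by move: (cx i); rewrite ltr_norml => /andP[]; lra.
  exists (Ordinal kK) => /=; move: ku; rewrite -natr1 mulrDl mul1r => ku.
  by rewrite ltr_norml; lra.
exists [ffun i => projT1 (cid (h i))]; split => // j i.
by rewrite (ord1 j) mxE ffunE /ball/=; case: cid.
Qed.

Section Counting.
Context {R : realType} {d : nat} (A : set 'rV[R]_d).
Implicit Type t : R.

Lemma Theta_ge0 t : (0 <= Theta A t)%E.
Proof. by apply/ereal_infP => _ [n _ <-]; rewrite lee_fin. Qed.

Lemma Theta'_ge0 t : (0 <= Theta' A t)%E.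
Proof.
apply: ereal_sup_ubound; exists 0%N => //.
by exists (fun=> 0); split => [[]//|]; apply/trivIsetP => -[].
Qed.

Lemma Theta'_le_Theta t : 0 < t -> (Theta' A t <= Theta A t)%E.
Proof.
move=> t0; apply/ereal_supP => _ [n [c [Mc c_disj]] <-].
apply/ereal_infP => _ [m [U [U_small MU]] <-]; rewrite lee_fin ler_nat.
have h i : exists j, U j (c i) by have [j _ ?] := MU _ (Mc i); exists j.
pose f i := projT1 (cid (h i)).
have fP i : U (f i) (c i) by rewrite /f; case: cid.
(* Two centers in one member of the cover are at most [t] apart, so their balls meet and
   disjointness forces equal indices. *)
have finj : injective f.
  move=> i j fij; apply: c_disj => //; apply: eball_meet => //.
  rewrite -lee_fin (le_trans _ (U_small (f i)).2)//; apply: ereal_sup_ubound.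
  by exists (c i) => //; exists (c j) => //; rewrite fij.
by have := leq_card f finj; rewrite !card_ord.
Qed.

(** A point whose ball met no ball of the packing could be added as a further center. *)
Lemma maximal_packing t n (c : 'I_n -> 'rV[R]_d) :
  (forall i, Mset A t (c i)) ->
  trivIset setT (fun i => eball (c i) t) ->
  ~ (exists c' : 'I_n.+1 -> 'rV[R]_d, (forall i, Mset A t (c' i)) /\
      trivIset setT (fun i => eball (c' i) t)) ->
  forall x, Mset A t x -> exists i, eball (c i) t `&` eball x t !=set0.
Proof.
move=> Mc c_disj nomore x Mx; apply: contrapT => nomeet; apply: nomore.
exists (fun i => if unlift ord0 i is Some j then c j else x).
split=> [i|i j _ _]; first by case: unliftP.
case: unliftP => [i' ->|->]; case: unliftP => [j' ->|->] // ij.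
- by rewrite (c_disj i' j').
- by case: nomeet; exists i'.
- by case: nomeet; exists j'; rewrite setIC.
Qed.

Lemma Theta_le_Theta' t : (0 < d)%N -> 0 < t ->
  (Theta A t <= ((8 * d) ^ d)%:R%:E * Theta' A t)%E.
Proof.
move=> d0 t0.
have d0R : 0 < d%:R :> R by rewrite ltr0n.
pose S := [set n : nat | exists c : 'I_n -> 'rV[R]_d,
  (forall i, Mset A t (c i)) /\ trivIset setT (fun i => eball (c i) t)].
(* Either some packing size cannot be raised by one, or induction from the empty packing yields
   every size. *)
have [[n [[c [Mc c_disj]] nS]]|unb] := pselect (exists n, S n /\ ~ S n.+1).
  have cover := maximal_packing t n c Mc c_disj nS.
  apply: (@le_trans _ _ (((8 * d) ^ d)%:R%:E * n%:R%:E)%E); last first.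
    rewrite lee_wpmul2l ?lee_fin//; apply: ereal_sup_ubound.
    by exists n => //; exists c.
  pose I := ('I_n * {ffun 'I_d -> 'I_(8 * d)})%type.
  have cardI : #|{: I}| = ((8 * d) ^ d * n)%N.
    by rewrite card_prod card_ffun !card_ord mulnC.
  (* With this [s] the diameter bound [d%:R * (2 * s)] is exactly [t], and [8 * d] steps of length
     [s] span the side [4 * t] of a cube. *)
  pose s := t / (2 * d%:R).
  have s0 : 0 < s by rewrite divr_gt0// mulr_gt0.
  rewrite -EFinM -natrM -cardI; apply: ereal_inf_lbound; exists #|{: I}| => //.
  exists (fun k => ball (grid (c (enum_val k).1) t s (enum_val k).2) s).
  split=> [k|x Mx].
    split; first exact: ball_open.
    apply: (le_trans (diameter_ball_le _ _)); rewrite lee_fin /s le_eqVlt.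
    by apply/orP; left; apply/eqP; field; rewrite gt_eqF.
  have [i /eball_meet_coord xi] := cover x Mx.
  have [|f xf] := grid_cover (K := 8 * d) (c i) x t s s0 _ xi.
    rewrite /s natrM le_eqVlt; apply/orP; left; apply/eqP; field.
    by rewrite gt_eqF.
  by exists (enum_rank ((i, f) : I)) => //; rewrite enum_rankK.
(* Arbitrarily large packings: the right-hand side is +oo. *)
have SS n : S n.
  elim: n => [|n Sn]; last by apply: contrapT => ?; apply: unb; exists n.
  by exists (fun=> 0); split => [[]//|[]].
suff -> : Theta' A t = +oo%E.
  by rewrite gt0_muley ?leey// lte_fin ltr0n expn_gt0 muln_gt0 d0.
apply/eqyP => r r0; apply: (@le_trans _ _ (Num.truncn r).+1%:R%:E).
  by rewrite lee_fin ltW// truncnS_gt.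
by apply: ereal_sup_ubound; exists (Num.truncn r).+1 => //; exact: SS.
Qed.

End Counting.

Theorem lemma4p5 (R : realType) (d : nat) (hd : (2 <= d)%N)
    (A : set 'rV[R]_d) (A0 : A !=set0) (cA : compact A) :
  upper_outer_box_dim A = upper_log_rate (Theta' A) /\
  lower_outer_box_dim A = lower_log_rate (Theta' A).
Proof.
have d0 : (0 < d)%N by exact: leq_trans hd.
have le1 : forall e : R, 0 < e -> \forall t \near 0^'+,
    (lne (Theta A t) / (- ln t)%:E <= lne (Theta' A t) / (- ln t)%:E + e%:E)%E.
  apply: (@lne_ratio_le_near _ _ _ ((8 * d) ^ d)%:R) => [|t _|t t0].
  - by rewrite ltr0n expn_gt0 muln_gt0 d0.
  - by split; [exact: Theta_ge0|exact: Theta'_ge0].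
  - exact: Theta_le_Theta'.
have le2 : forall e : R, 0 < e -> \forall t \near 0^'+,
    (lne (Theta' A t) / (- ln t)%:E <= lne (Theta A t) / (- ln t)%:E + e%:E)%E.
  apply: (@lne_ratio_le_near _ _ _ 1) => // [t _|t t0].
  - by split; [exact: Theta'_ge0|exact: Theta_ge0].
  - by rewrite mul1e; exact: Theta'_le_Theta.
split; apply/eqP; rewrite eq_le; apply/andP; split.
- exact: limf_esup_le_near.
- exact: limf_esup_le_near.
- exact: limf_einf_le_near.
- exact: limf_einf_le_near.
Qed.
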